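(* Let $R$ be a ring. If every compatible descending system of right coprime pairs of $R$ has a minimal lower bound, then $R/J(R)$ is left continuous.
   Context: Rings are associative with identity. $J(R)$ is the Jacobson radical of $R$. A left module $M$ is continuous if it satisfies: (C1) every submodule of $M$ is essential in a direct summand of $M$; (C2) any submodule of $M$ that is isomorphic to a direct summand of $M$ is itself a direct summand of $M$. A ring is left continuous if it is continuous as a left module over itself. A right coprime pair in $R$ is a pair of elements $a,b\in R$ with $aR+bR=R$. Two right coprime pairs $(a,b)$, $(a',b')$ are identified when $aR=a'R$ and $bR=b'R$; $\langle a,b\rangle$ denotes the equivalence class, $\mathrm{RCP}(R)$ the set of all classes, and a pair $(a',b')$ with $\langle a',b'\rangle=\langle a,b\rangle$ is called a pair of generators of $\langle a,b\rangle$. $\mathrm{RCP}(R)$ is partially ordered by $\langle a,b\rangle\le\langle a',b'\rangle$ iff $aR\subseteq a'R$ and $bR\subseteq b'R$. A descending system of right coprime pairs is a family $\{p_i\mid i\in I\}\subseteq\mathrm{RCP}(R)$ indexed by an (upward) directed partially ordered set $I$ such that $p_j\le p_i$ whenever $i\le j$. It is called compatible if there exist a pair of generators $(a_i,b_i)$ of $p_i$ for each $i\in I$, and elements $r_{ij},s_{ij}\in R$ for all $i<j$ in $I$, such that $a_j=a_ir_{ij}$ and $b_j=b_is_{ij}$ for all $i<j$ in $I$, and $r_{ik}=r_{ij}r_{jk}$ and $s_{ik}=s_{ij}s_{jk}$ for all $i<j<k$ in $I$. A minimal lower bound of a system is a lower bound of it in $\mathrm{RCP}(R)$ that is a minimal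 element of the poset $\mathrm{RCP}(R)$. *)

(* Defs.v *)
From HB Require Import structures.
From mathcomp Require Import all_boot all_order all_algebra.
From mathcomp Require Import generic_quotient ring_quotient.
From mathcomp Require Import boolp classical_sets functions.

Set Implicit Arguments.
Unset Strict Implicit.
Unset Printing Implicit Defensive.

Import Order.TTheory GRing.Theory.

Local Open Scope classical_set_scope.
Local Open Scope ring_scope.
Local Open Scope quotient_scope.

(* Elementwise sum of two subsets of an additive group. *)
Definition add_set (V : zmodType) (A B : set V) : set V :=
  [set x + y | x in A & y in B].

Section Modules.
Variables (R : pzRingType) (M : lmodType R).
Implicit Types N D E K : set M.

Definition submodule N : Prop := submod_closed [in N].

Definition direct_summand D : Prop :=
  submodule D /\
  exists E, [/\ submodule E, D `&` E = [set 0] & add_set D E = [set: M]].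

Definition essential_in N D : Prop :=
  N `<=` D /\
  forall K, submodule K -> K `<=` D -> K `&` N = [set 0] -> K = [set 0].

(* An isomorphism N -> D is represented by a function on M whose values outside
   N are irrelevant. *)
Definition isomorphic_submodules N D : Prop :=
  exists f : M -> M,
    {in N &, forall x y, forall a : R, f (a *: x + y) = a *: f x + f y} /\
    set_bij N D f.

Definition continuous_C1 : Prop :=
  forall N, submodule N -> exists D, direct_summand D /\ essential_in N D.

Definition continuous_C2 : Prop :=
  forall N D, submodule N -> direct_summand D -> isomorphic_submodules N D ->
    direct_summand N.

Definition continuous_module : Prop := continuous_C1 /\ continuous_C2.

End Modules.

(* [R^o] is R as a left module over itself. *)
Definition left_continuous (R : pzRingType) : Prop := continuous_module R^o.

Section JacobsonRadical.
Variable R : pzRingType.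

Definition left_ideal (L : set R) : Prop := @submodule R R^o L.

Definition maximal_left_ideal (L : set R) : Prop :=
  [/\ left_ideal L, L <> [set: R] &
      forall L', left_ideal L' -> L `<=` L' -> L' <> [set: R] -> L' = L].

Definition jacobson_radical : set R :=
  \bigcap_(L in [set L | maximal_left_ideal L]) L.

Lemma left_idealP (L : set R) : left_ideal L <->
  [/\ L 0, forall x y, L x -> L y -> L (x + y) & forall a x, L x -> L (a * x)].
Proof.
split=> [[/set_mem L0 LD]|[L0 LD LM]].
  have LE a x y : L x -> L y -> L (a * x + y).
    by move=> /mem_set Lx /mem_set Ly; apply/set_mem/(LD a).
  split=> // [x y Lx Ly|a x Lx]; first by rewrite -[x]mul1r; apply: LE.
  by rewrite -[_ * _]addr0; apply: LE.
split; first exact/mem_set.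
by move=> a x y /set_mem Lx /set_mem Ly; apply/mem_set/LD => //; apply: LM.
Qed.

Lemma jacobson_left_ideal : left_ideal jacobson_radical.
Proof.
apply/left_idealP; split=> [L maxL|x y Jx Jy L maxL|a x Jx L maxL];
  have [/left_idealP[L0 LD LM] _ _] := maxL => //.
- by apply: LD; [apply: Jx|apply: Jy].
- by apply: LM; apply: Jx.
Qed.

Lemma jacobsonMr x r : jacobson_radical x -> jacobson_radical (x * r).
Proof.
move=> Jx L maxL; have [/left_idealP[L0 LD LM] Lproper Lmax] := maxL.
have LN y : L y -> L (- y) by rewrite -mulN1r; apply: LM.
have [Lr|nLr] := pselect (L r); first exact: LM.
apply: (Jx [set y | L (y * r)]); split.
- apply/left_idealP; split=> /= [|y z Ly Lz|a y Ly]; first by rewrite mul0r.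
    by rewrite mulrDl; apply: LD.
  by rewrite -mulrA; apply: LM.
- by move=> /seteqP[_ /(_ 1 I)] /=; rewrite mul1r.
move=> L' /left_idealP[L'0 L'D L'M] subL L'proper; apply/seteqP; split=> // y L'y.
apply: contrapT => /= nLyr; apply: L'proper.
pose P := [set z | exists m s, L m /\ z = m + s * (y * r)].
have PT : P = [set: R].
  apply: contrapT => Pproper.
  have PL : P = L.
    apply: Lmax => // [|z Lz]; last by exists z, 0; rewrite mul0r addr0.
    apply/left_idealP; split.
    - by exists 0, 0; rewrite mul0r addr0.
    - move=> _ _ [m [s [Lm ->]]] [m' [s' [Lm' ->]]].
      by exists (m + m'), (s + s'); split; [exact: LD|rewrite mulrDl addrACA].
    - move=> a _ [m [s [Lm ->]]].
      by exists (a * m), (a * s); split; [exact: LM|rewrite mulrDr !mulrA].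
  by apply: nLyr; rewrite -PL; exists 0, 1; rewrite add0r mul1r.
have [m [s [Lm rE]]] : P r by rewrite PT.
have L'1 : L' 1.
  rewrite -(subrK (s * y) 1); apply: L'D; last exact: L'M.
  apply: subL => /=; rewrite mulrBl mul1r -mulrA.
  by rewrite {1}rE addrK.
by apply/seteqP; split=> // z _; rewrite -[z]mulr1; apply: L'M.
Qed.

Definition jacobson_pred : {pred R} := [in jacobson_radical].

Lemma jacobson_zmod_closed : zmod_closed jacobson_pred.
Proof. exact: GRing.submod_closedB jacobson_left_ideal. Qed.

HB.instance Definition _ :=
  GRing.isZmodClosed.Build R jacobson_pred jacobson_zmod_closed.

(* The ring R / J(R); the library only provides the ring structure on [quot]
   for commutative rings. *)
Definition jacobson_quot : Type := Quotient.quot jacobson_pred.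

HB.instance Definition _ := GRing.Zmodule.on jacobson_quot.
HB.instance Definition _ := EqQuotient.on jacobson_quot.

Lemma jacobson_quotE (x y : R) :
  \pi_jacobson_quot x = \pi_jacobson_quot y <-> jacobson_radical (x - y).
Proof.
split=> [/eqP|Jxy]; first by rewrite -Quotient.idealrBE => /set_mem.
by apply/eqP; rewrite -Quotient.idealrBE; apply/mem_set.
Qed.

Lemma jacobson_quotD (x y : R) :
  \pi_jacobson_quot (x + y) = \pi_jacobson_quot x + \pi_jacobson_quot y.
Proof. exact: (raddfD (\pi_(Quotient.quot jacobson_pred))). Qed.

Definition jacobson_quot_one : jacobson_quot := \pi_jacobson_quot 1.
Definition jacobson_quot_mul := lift_op2 jacobson_quot *%R.

Lemma jacobson_quot_mulE (x y : R) :
  jacobson_quot_mul (\pi_jacobson_quot x) (\pi_jacobson_quot y) =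
    \pi_jacobson_quot (x * y).
Proof.
have [J0 JD JM] := (left_idealP _).1 jacobson_left_ideal.
have J_repr z : jacobson_radical (repr (\pi_jacobson_quot z) - z).
  by apply/jacobson_quotE; rewrite reprK.
unlock jacobson_quot_mul; apply/jacobson_quotE; set x' := repr _; set y' := repr _.
rewrite -(subrK (x' * y) (x' * y')) -addrA -mulrBr -mulrBl.
by apply: JD; [apply: JM; apply: J_repr|apply: jacobsonMr; apply: J_repr].
Qed.

Fact jacobson_quot_mulA : associative jacobson_quot_mul.
Proof.
by move=> u v w; rewrite -[u]reprK -[v]reprK -[w]reprK
     !jacobson_quot_mulE mulrA.
Qed.

Fact jacobson_quot_mul1q : left_id jacobson_quot_one jacobson_quot_mul.
Proof. by move=> u; rewrite -[u]reprK jacobson_quot_mulE mul1r. Qed.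

Fact jacobson_quot_mulq1 : right_id jacobson_quot_one jacobson_quot_mul.
Proof. by move=> u; rewrite -[u]reprK jacobson_quot_mulE mulr1. Qed.

Fact jacobson_quot_mulDl : left_distributive jacobson_quot_mul +%R.
Proof.
by move=> u v w; rewrite -[u]reprK -[v]reprK -[w]reprK
     -jacobson_quotD !jacobson_quot_mulE -jacobson_quotD mulrDl.
Qed.

Fact jacobson_quot_mulDr : right_distributive jacobson_quot_mul +%R.
Proof.
by move=> u v w; rewrite -[u]reprK -[v]reprK -[w]reprK
     -jacobson_quotD !jacobson_quot_mulE -jacobson_quotD mulrDr.
Qed.

HB.instance Definition _ := GRing.Zmodule_isPzRing.Build jacobson_quot
  jacobson_quot_mulA jacobson_quot_mul1q jacobson_quot_mulq1
  jacobson_quot_mulDl jacobson_quot_mulDr.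

Lemma jacobson_quotM (x y : R) :
  \pi_jacobson_quot (x * y) = \pi_jacobson_quot x * \pi_jacobson_quot y.
Proof. by rewrite [RHS]jacobson_quot_mulE. Qed.

Lemma jacobson_quot1 : \pi_jacobson_quot 1 = 1.
Proof. by []. Qed.

End JacobsonRadical.

Section CoprimePairs.
Variable R : pzRingType.

(* The principal right ideal aR. *)
Definition principal_right_ideal (a : R) : set R := range (fun r => a * r).

Definition right_coprime (a b : R) : Prop :=
  add_set (principal_right_ideal a) (principal_right_ideal b) = [set: R].

Definition coprime_pair : Type :=
  {q : R * R | `[< right_coprime q.1 q.2 >]}.

HB.instance Definition _ := Choice.on coprime_pair.

Definition same_ideals (q q' : coprime_pair) : bool :=
  `[< principal_right_ideal (val q).1 = principal_right_ideal (val q').1 /\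
      principal_right_ideal (val q).2 = principal_right_ideal (val q').2 >].

Lemma same_ideals_equiv : equiv_class_of same_ideals.
Proof.
split=> [q|q q'|q q' q'']; first exact/asboolP.
  by apply/asboolP/asboolP => -[e1 e2]; split.
by move=> /asboolP[e1 e2] /asboolP[e1' e2']; apply/asboolP; rewrite e1 e2.
Qed.

Canonical same_ideals_equivRel := EquivRelPack same_ideals_equiv.
Canonical same_ideals_encModRel := defaultEncModRel same_ideals.

Definition RCP : Type := {eq_quot same_ideals}.

HB.instance Definition _ := EqQuotient.on RCP.
HB.instance Definition _ := Choice.on RCP.

Definition generators (p : RCP) (a b : R) : Prop :=
  exists q : coprime_pair, val q = (a, b) /\ \pi_RCP q = p.

Definition rcp_le (p p' : RCP) : bool :=
  `[< principal_right_ideal (val (repr p)).1 `<=`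
        principal_right_ideal (val (repr p')).1 /\
      principal_right_ideal (val (repr p)).2 `<=`
        principal_right_ideal (val (repr p')).2 >].

Fact rcp_le_refl : reflexive rcp_le.
Proof. by move=> p; apply/asboolP; split. Qed.

Fact rcp_le_anti : antisymmetric rcp_le.
Proof.
move=> p p' /andP[/asboolP[le1 le2] /asboolP[ge1 ge2]].
rewrite -[p]reprK -[p']reprK; apply/eqquotP/asboolP.
by split; apply/seteqP.
Qed.

Fact rcp_le_trans : transitive rcp_le.
Proof.
move=> p' p p'' /asboolP[l1 l2] /asboolP[l1' l2']; apply/asboolP.
by split; [apply: subset_trans l1'|apply: subset_trans l2'].
Qed.

Fact rcp_display : Order.disp_t. Proof. exact: Order.Disp tt tt. Qed.

HB.instance Definition _ := Order.Le_isPOrder.Build rcp_display RCP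
  rcp_le_refl rcp_le_anti rcp_le_trans.

Lemma rcp_le_generators (p p' : RCP) (a b a' b' : R) :
  generators p a b -> generators p' a' b' ->
  (p <= p')%O <->
    principal_right_ideal a `<=` principal_right_ideal a' /\
    principal_right_ideal b `<=` principal_right_ideal b'.
Proof.
have reprE q : same_ideals (repr (\pi_RCP q)) q.
  by apply/eqquotP; exact: (reprK (\pi_RCP q)).
move=> [q [qE <-]] [q' [q'E <-]]; rewrite /Order.le /= /rcp_le.
have /asboolP[-> ->] := reprE q; have /asboolP[-> ->] := reprE q'.
by rewrite qE q'E; split=> [/asboolP|?] //; apply/asboolP.
Qed.

End CoprimePairs.

Definition directed d (I : porderType d) : Prop :=
  inhabited I /\ forall i j : I, exists k, (i <= k)%O /\ (j <= k)%O.

Section Systems.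
Variables (R : pzRingType) (d : Order.disp_t) (I : porderType d).
Variable p : I -> RCP R.

Definition descending_system : Prop :=
  directed I /\ forall i j, (i <= j)%O -> (p j <= p i)%O.

Definition compatible : Prop :=
  exists (a b : I -> R) (r s : I -> I -> R),
    [/\ forall i, generators (p i) (a i) (b i),
        forall i j, (i < j)%O -> a j = a i * r i j /\ b j = b i * s i j &
        forall i j k, (i < j)%O -> (j < k)%O ->
          r i k = r i j * r j k /\ s i k = s i j * s j k].

Definition minimal_lower_bound (m : RCP R) : Prop :=
  (forall i, (m <= p i)%O) /\ (forall q : RCP R, (q <= m)%O -> q = m).

End Systems.

(* Main.v *)
(* Write S = R/J(R). A minimal right coprime pair is of the form <e, 1 - e> with
   e idempotent, so every compatible descending system lies above such a pair;
   in particular R is an exchange ring. Order idempotents by inclusion of the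
   left ideals Re. For a chain of idempotents e_i, the elements 1 - e_i satisfy
   (1 - e_i)(1 - e_j) = 1 - e_j for i < j, so systems built from them are
   compatible for free.
   - The system <a, 1 - e_i> bounds a chain of idempotents of aR by an idempotent
     of aR; a maximal idempotent e of aR has (1 - e)a in J(R), so S is von Neumann
     regular. Then (C2) holds because an isomorphic copy of a summand is a
     principal left ideal.
   - For a chain (e_i), let f be maximal with S f independent of the union of the
     S e_i. A minimal lower bound of <1 - f, 1 - e_i> gives an idempotent h such
     that the union of the S e_i is essential in S h. Zorn's lemma then yields an
     essential extension S e of any left ideal N of S, which is (C1). *)

Require Import Defs.
From HB Require Import structures.
From mathcomp Require Import all_boot all_order all_algebra.
From mathcomp Require Import generic_quotient ring_quotient.
From mathcomp Require Import boolp classical_sets functions.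

Set Implicit Arguments.
Unset Strict Implicit.
Unset Printing Implicit Defensive.

Import Order.TTheory GRing.Theory.

Local Open Scope classical_set_scope.
Local Open Scope ring_scope.
Local Open Scope quotient_scope.

(** * Principal right ideals and minimal coprime pairs *)

Section PrincipalRightIdeals.
Variable R : pzRingType.
Implicit Types a b e x y : R.

Lemma principal_right_idealM a x : principal_right_ideal a (a * x).
Proof. by exists x. Qed.

Lemma principal_right_ideal_sub a b :
  principal_right_ideal a b ->
  principal_right_ideal b `<=` principal_right_ideal a.
Proof. by move=> [x _ <-] _ [y _ <-]; exists (x * y); rewrite ?mulrA. Qed.

Lemma principal_right_ideal_self a : principal_right_ideal a a.
Proof. by exists 1; rewrite ?mulr1. Qed.

Lemma right_coprimeP a b :
  right_coprime a b <-> exists x y, a * x + b * y = 1.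
Proof.
split=> [ab|[x [y ab]]].
  have [_ [x _ <-] [_ [y _ <-] abE]] :
      add_set (principal_right_ideal a) (principal_right_ideal b) 1 by rewrite ab.
  by exists x, y.
apply/seteqP; split=> // z _; exists (a * (x * z)); first by exists (x * z).
by exists (b * (y * z)); [exists (y * z)|rewrite !mulrA -mulrDl ab mul1r].
Qed.

Lemma right_coprime_sub a b a' b' :
  principal_right_ideal a a' -> principal_right_ideal b b' ->
  right_coprime a' b' -> right_coprime a b.
Proof.
move=> [x _ <-] [y _ <-] /right_coprimeP[z [t E]]; apply/right_coprimeP.
by exists (x * z), (y * t); rewrite !mulrA.
Qed.

Lemma right_coprimeC e : right_coprime e (1 - e).
Proof. by apply/right_coprimeP; exists 1, 1; rewrite !mulr1 addrC subrK. Qed.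

Lemma mulr_compl e x : e * x = e -> e * (1 - x) = 0.
Proof. by move=> ex; rewrite mulrBr mulr1 ex subrr. Qed.

(** The idempotent [e] kills [(1 - e)R] from the left. This turns a bound on second components into
    the inclusion of [Re] in [Rx]. *)
Lemma mul_compl_idem e x : e * e = e ->
  principal_right_ideal (1 - e) (1 - x) -> e * x = e.
Proof.
move=> ee [y _ E]; apply/esym/eqP; rewrite -subr_eq0 -{1}[e]mulr1 -mulrBr -E.
by rewrite mulrA mulr_compl // mul0r.
Qed.

Lemma compl_idem e : e * e = e -> (1 - e) * (1 - e) = 1 - e.
Proof. by move=> ee; rewrite mulrBl mul1r mulr_compl // subr0. Qed.

Lemma generatorsP (p : RCP R) : exists a b, generators p a b.
Proof.
exists (val (repr p)).1, (val (repr p)).2, (repr p).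
by rewrite reprK; split=> //; case: (val _).
Qed.

Lemma generators_coprime (p : RCP R) a b : generators p a b -> right_coprime a b.
Proof. by move=> [[q /= /asboolP cq] [/= qE _]]; rewrite qE in cq. Qed.

Lemma coprime_generators a b : right_coprime a b ->
  exists p : RCP R, generators p a b.
Proof.
move=> ab; have abP : `[< right_coprime (a, b).1 (a, b).2 >] by apply/asboolP.
by exists (\pi_(RCP R) (exist _ (a, b) abP)); exists (exist _ (a, b) abP).
Qed.

(* With 1 = ax + by and e = ax, minimality gives eR = aR and (1 - e)R = bR.
   The coprime pair (e^2, 1 - e) then yields e = e^2 y, and k = 1 - ey lies in
   the right annihilator of e, which is contained in (1 - e)R; the coprime pair
   (e, k) forces (1 - e)R = kR, hence e(1 - e) = 0. *)
Lemma minimal_idempotent (m : RCP R) : (forall q : RCP R, (q <= m)%O -> q = m) ->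
  exists e, e * e = e /\ generators m e (1 - e).
Proof.
have [a0 [b0 m0]] := generatorsP m => minm.
have descend a b a' b' : generators m a b -> right_coprime a' b' ->
    principal_right_ideal a a' -> principal_right_ideal b b' ->
    generators m a' b'.
  move=> mab /coprime_generators[q q'] aa' bb'.
  suff /minm <- : (q <= m)%O by [].
  by apply/(rcp_le_generators q' mab); split; exact: principal_right_ideal_sub.
have gen_sub a b a' b' : generators m a b -> generators m a' b' ->
    principal_right_ideal a a' /\ principal_right_ideal b b'.
  move=> mab mab'; have [sa sb] := (rcp_le_generators mab' mab).1 (lexx m).
  by split; [apply: sa|apply: sb]; exact: principal_right_ideal_self.
have /right_coprimeP[x [y xy]] := generators_coprime m0.
pose e := a0 * x; have byE : b0 * y = 1 - e by rewrite -xy addrC addKr.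
have me : generators m e (1 - e).
  apply: descend m0 (right_coprimeC e) _ _; first by exists x.
  by exists y.
exists e; split=> //.
have me2 : generators m (e * e) (1 - e).
  apply: descend me _ (principal_right_idealM _ _)
    (principal_right_ideal_self _).
  apply/right_coprimeP; exists 1, (1 + e).
  by rewrite mulr1 mulrDr mulr1 mulrBl mul1r subrKA addrC subrK.
have [[z _ ez] _] := gen_sub _ _ _ _ me2 me.
pose k := 1 - e * z; have ek : e * k = 0 by rewrite mulrBr mulr1 mulrA ez subrr.
have mk : generators m e k.
  apply: descend me _ (principal_right_ideal_self _) _.
    by apply/right_coprimeP; exists z, 1; rewrite mulr1 addrC subrK.
  by exists k; rewrite // mulrBl mul1r ek subr0.
have [_ [t _ tE]] := gen_sub _ _ _ _ mk me.
have : e * (1 - e) = 0 by rewrite -tE mulrA ek mul0r.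
by rewrite mulrBr mulr1 => /subr0_eq.
Qed.

End PrincipalRightIdeals.

(** * From the hypothesis to idempotent lower bounds *)

Section OrderedBy.
Variables (T : choiceType) (le : rel T).
Hypotheses (le_refl : reflexive le) (le_anti : antisymmetric le).
Hypothesis le_trans : transitive le.

(** The order laws are arguments of the alias, so that a poset structure can be attached to a
    relation built inside a proof. *)
Definition ordered_by of reflexive le & antisymmetric le & transitive le : Type
  := T.
Local Notation I := (ordered_by le_refl le_anti le_trans).

HB.instance Definition _ := Choice.on I.

Fact ordered_by_display : Order.disp_t. Proof. exact: Order.Disp tt tt. Qed.

HB.instance Definition _ := Order.Le_isPOrder.Build ordered_by_display I
  le_refl le_anti le_trans.

End OrderedBy.

Definition has_minimal_lower_bounds (R : pzRingType) : Prop :=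
  forall (d : Order.disp_t) (I : porderType d) (p : I -> RCP R),
    descending_system p -> compatible p ->
    exists m : RCP R, minimal_lower_bound p m.

(** The minimal lower bound has generators [(e, 1 - e)], so lying below each pair becomes two
    memberships. *)
Lemma idempotent_lower_bound (R : pzRingType) (T : choiceType) (le : rel T)
    (a b : T -> R) (r s : T -> T -> R) :
  has_minimal_lower_bounds R ->
  reflexive le -> antisymmetric le -> transitive le ->
  inhabited T -> (forall i j, exists k, le i k /\ le j k) ->
  (forall i, right_coprime (a i) (b i)) ->
  (forall i j, le i j -> a j = a i * r i j /\ b j = b i * s i j) ->
  (forall i j k, le i j -> le j k ->
    r i k = r i j * r j k /\ s i k = s i j * s j k) ->
  exists e, e * e = e /\
    forall i, principal_right_ideal (a i) e /\ principal_right_ideal (b i) (1 - e).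
Proof.
move=> hR lexx le_anti le_trans T0 dir cop ab rs.
have /choice[p pE] i := coprime_generators (cop i).
have [] := hR _ (ordered_by lexx le_anti le_trans) p.
- split=> // i j le_ij; apply/(rcp_le_generators (pE j) (pE i)).
  have [-> ->] := ab i j le_ij.
  by split; apply: principal_right_ideal_sub; exact: principal_right_idealM.
- exists a, b, r, s; split=> // [i j /ltW|i j k /ltW ij /ltW]; first exact: ab.
  exact: rs.
move=> m [lb /minimal_idempotent[e [ee me]]]; exists e; split=> // i.
have /(rcp_le_generators me (pE i))[sa sb] := lb i.
by split; [apply: sa|apply: sb]; exact: principal_right_ideal_self.
Qed.

(** * Chains of idempotents *)

Section IdempotentChains.
Variable R : pzRingType.
Implicit Types (e f g h k : R) (P Q : set R).

(* The inclusion Re `<=` Rf is only a preorder; distinct idempotents with the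
   same left ideal are made incomparable to obtain a partial order. *)
Definition left_ideal_le e f : bool :=
  (e == f) || ((e * f == e) && (f * e != f)).

Lemma left_ideal_le_refl : reflexive left_ideal_le.
Proof. by move=> e; rewrite /left_ideal_le eqxx. Qed.

Lemma left_ideal_le_anti : antisymmetric left_ideal_le.
Proof.
move=> e f /andP[/orP[/eqP//|/andP[_ /eqP fe]] /orP[/eqP//|/andP[/eqP fe' _]]].
by case: fe.
Qed.

Lemma left_ideal_le_trans : transitive left_ideal_le.
Proof.
move=> f e g /orP[/eqP->//|/andP[/eqP ef /eqP fe]].
move=> /orP[/eqP<-|/andP[/eqP fg _]]; apply/orP; right.
  by rewrite ef eqxx; apply/eqP.
apply/andP; split; first by rewrite -{1}ef -mulrA fg ef.
by apply/eqP => ge; apply: fe; rewrite -{1}fg -mulrA ge fg.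
Qed.

Lemma left_ideal_leM e f : e * e = e -> left_ideal_le e f -> e * f = e.
Proof. by move=> ee /orP[/eqP<-|/andP[/eqP]]. Qed.

Lemma left_ideal_le_compl e f : e * e = e -> left_ideal_le e f ->
  (1 - e) * (1 - f) = 1 - f.
Proof.
by move=> ee /(left_ideal_leM ee) ef; rewrite mulrBl mul1r mulr_compl ?subr0.
Qed.

Lemma maximal_idempotent Q e0 : Q e0 ->
  (forall P, P `<=` Q -> P !=set0 -> total_on P left_ideal_le ->
    exists h, Q h /\ forall e, P e -> e * h = e) ->
  exists e, Q e /\ forall f, Q f -> e * f = e -> f * e = f.
Proof.
move=> Q0 ubQ; pose le (e f : Q) := left_ideal_le (val e) (val f).
have [||||e emax] := @Zorn Q le.
- by move=> e; exact: left_ideal_le_refl.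
- by move=> f e g; exact: left_ideal_le_trans.
- by move=> e f ef fe; apply/val_inj/left_ideal_le_anti; rewrite [X in X && _]ef.
- move=> A totA; have [A0|A0] := pselect (exists e : Q, A e); last first.
    by exists (exist _ e0 (mem_set Q0)) => e Ae; case: A0; exists e.
  pose P : set R := [set val e | e in A].
  have [||| h [Qh Ph]] := ubQ P.
  + by move=> _ [e _ <-]; exact/set_mem/valP.
  + by have [e Ae] := A0; exists (val e), e.
  + by move=> _ _ [e Ae <-] [f Af <-]; exact: totA.
  have {}Ph (e : Q) : A e -> val e * h = val e by move=> Ae; apply: Ph; exists e.
  (* The bound [h] may generate the same left ideal as a member [e] of the chain without being
     comparable to it; then [e] itself bounds the chain. *)
  have [[e [Ae he]]|nhe] := pselect (exists e : Q, A e /\ h * val e = h).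
    exists e => f Af; rewrite /le; have := totA _ _ Af Ae.
    move=> [//|/orP[/eqP->|/andP[_ /eqP[]]]].
      exact: left_ideal_le_refl.
    by rewrite -(Ph f Af) -mulrA he.
  exists (exist _ h (mem_set Qh)) => e Ae; apply/orP; right => /=.
  rewrite Ph // eqxx /=; apply/eqP => he; case: nhe; by exists e.
exists (val e); split=> [|f Qf ef]; first exact/set_mem/valP.
apply: contrapT => fe; apply: (fe).
have /(congr1 val) /= fE : exist _ f (mem_set Qf) = e.
  by apply: emax; apply/orP; right; rewrite /= ef eqxx; apply/eqP.
by move: ef; rewrite fE.
Qed.

Hypothesis hR : has_minimal_lower_bounds R.

(** Take the system over a one-point index set whose only pair is [<x, 1 - x>]. *)
Lemma exchange x : exists e, [/\ e * e = e, principal_right_ideal x e &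
  principal_right_ideal (1 - x) (1 - e)].
Proof.
have [//|||||||| e [ee /(_ tt)[xe xe']]] :=
  @idempotent_lower_bound R unit (fun _ _ => true) (fun=> x)
  (fun=> 1 - x) (fun _ _ => 1) (fun _ _ => 1) hR.
- by case; case.
- by [].
- by constructor; exact: tt.
- by move=> *; exists tt.
- by move=> _; exact: right_coprimeC.
- by move=> *; rewrite !mulr1.
- by move=> *; rewrite !mulr1.
by exists e.
Qed.

Lemma chain_upper_bound a P : P !=set0 -> total_on P left_ideal_le ->
  (forall e, P e -> e * e = e /\ principal_right_ideal a e) ->
  exists h, [/\ h * h = h, principal_right_ideal a h &
    forall e, P e -> e * h = e].
Proof.
move=> [e0 P0] totP idP; have PP (e : P) : P (val e) by exact/set_mem/valP.
(* The second transition element depends only on its target, so compatibility reduces to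
   [(1 - f)(1 - g) = 1 - g] for [f] below [g]. *)
have [||||||||h [hh lbh]] := @idempotent_lower_bound R P
  (fun x y => left_ideal_le (val x) (val y)) (fun=> a) (fun x => 1 - val x)
  (fun _ _ => 1) (fun _ y => 1 - val y) hR.
- by move=> e; exact: left_ideal_le_refl.
- by move=> e f ef; apply/val_inj/left_ideal_le_anti.
- by move=> f e g; exact: left_ideal_le_trans.
- by constructor; exact: exist _ e0 (mem_set P0).
- move=> e f; have [ef|fe] := totP _ _ (PP e) (PP f).
    by exists f; split=> //; exact: left_ideal_le_refl.
  by exists e; split=> //; exact: left_ideal_le_refl.
- move=> e; apply: right_coprime_sub (right_coprimeC (val e)).
    by have [] := idP _ (PP e).
  exact: principal_right_ideal_self.
- move=> e f ef; rewrite mulr1 left_ideal_le_compl //.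
  by have [] := idP _ (PP e).
- move=> e f g _ fg; rewrite mulr1 left_ideal_le_compl //.
  by have [] := idP _ (PP f).
exists h; split=> [//||e Pe].
  by have [] := lbh (exist _ e0 (mem_set P0)).
have [_] := lbh (exist _ e (mem_set Pe)); apply: mul_compl_idem.
by have [] := idP _ Pe.
Qed.

(** The pairs [<1 - f, 1 - e>] are indexed by the product of the chains; a lower bound [<h, 1 - h>]
    puts every [Re] inside [Rh] and every [Rf] inside [R(1 - h)]. *)
Lemma separate_chains P Q : P !=set0 -> Q !=set0 ->
  total_on P left_ideal_le -> total_on Q left_ideal_le ->
  (forall e, P e -> e * e = e) -> (forall f, Q f -> f * f = f) ->
  (forall e f, P e -> Q f -> right_coprime (1 - f) (1 - e)) ->
  exists h, [/\ h * h = h, forall e, P e -> e * h = e,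
    forall e, P e -> principal_right_ideal (1 - e) (1 - h) &
    forall f, Q f -> f * (1 - h) = f].
Proof.
move=> [e0 P0] [f0 Q0] totP totQ idP idQ cop.
have PP (e : P) : P (val e) by exact/set_mem/valP.
have QQ (e : Q) : Q (val e) by exact/set_mem/valP.
have [||||||||g [gg lbg]] := @idempotent_lower_bound R (Q * P)%type
  (fun x y => left_ideal_le (val x.1) (val y.1) &&
     left_ideal_le (val x.2) (val y.2))
  (fun x => 1 - val x.1) (fun x => 1 - val x.2)
  (fun _ y => 1 - val y.1) (fun _ y => 1 - val y.2) hR.
- by move=> e; rewrite !left_ideal_le_refl.
- move=> [e1 e2] [f1 f2] /= /andP[/andP[l1 l2] /andP[l1' l2']].
  by congr (_, _); apply/val_inj/left_ideal_le_anti/andP.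
- move=> f e g /andP[l1 l2] /andP[l1' l2'].
  by rewrite (left_ideal_le_trans l1 l1') (left_ideal_le_trans l2 l2').
- by constructor; exact: (exist _ f0 (mem_set Q0), exist _ e0 (mem_set P0)).
- move=> [f e] [f' e'] /=.
  have [ef|fe] := totP _ _ (PP e) (PP e');
    have [ef'|fe'] := totQ _ _ (QQ f) (QQ f').
  + by exists (f', e'); rewrite /= ef ef' !left_ideal_le_refl.
  + by exists (f, e'); rewrite /= ef fe' !left_ideal_le_refl.
  + by exists (f', e); rewrite /= fe ef' !left_ideal_le_refl.
  + by exists (f, e); rewrite /= fe fe' !left_ideal_le_refl.
- by move=> x; exact: cop.
- by move=> x y /andP[l1 l2]; rewrite !left_ideal_le_compl //;
    [exact: idP|exact: idQ].
- by move=> x y z _ /andP[l1 l2]; rewrite !left_ideal_le_compl //;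
    [exact: idP|exact: idQ].
exists g.
have lbP e : P e -> principal_right_ideal (1 - e) (1 - g).
  by move=> Pe; have [] := lbg (exist _ f0 (mem_set Q0), exist _ e (mem_set Pe)).
split=> // [e Pe|f Qf]; first by apply: mul_compl_idem (lbP e Pe); exact: idP.
apply: mul_compl_idem; first exact: idQ.
rewrite subKr.
by have [] := lbg (exist _ f (mem_set Qf), exist _ e0 (mem_set P0)).
Qed.

End IdempotentChains.

Arguments left_ideal_le {R}.

(** * Von Neumann regular rings and (C2) *)

Definition regular_ring (S : pzRingType) : Prop :=
  forall x : S, exists y, x * y * x = x.

Section RegularRings.
Variable S : pzRingType.

(** The set is [Se]; its complement [S(1 - e)] is written as the left annihilator of [e]. *)
Lemma idempotent_direct_summand (e : S) : e * e = e ->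
  @direct_summand S S^o [set x | x * e = x].
Proof.
move=> ee; split.
  apply/left_idealP; split=> /= [|x y xe ye|a x xe]; first by rewrite mul0r.
    by rewrite mulrDl xe ye.
  by rewrite -mulrA xe.
exists [set x | x * e = 0]; split.
- apply/left_idealP; split=> /= [|x y xe ye|a x xe]; first by rewrite mul0r.
    by rewrite mulrDl xe ye addr0.
  by rewrite -mulrA xe mulr0.
- apply/seteqP; split=> [x [/= xe x0]|_ ->] /=; last by rewrite !mul0r.
  by rewrite -xe.
- apply/seteqP; split=> // x _; exists (x * e); first by rewrite /= -mulrA ee.
  exists (x - x * e); last by rewrite addrC subrK.
  by rewrite /= mulrBl -mulrA ee subrr.
Qed.

Hypothesis regS : regular_ring S.

(** Thus [Sx] is generated by the idempotent [zx]. *)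
Lemma regular_left_idempotent (x : S) :
  exists z, z * x * (z * x) = z * x /\ x * (z * x) = x.
Proof.
have [z xE] := regS x.
by exists z; rewrite -mulrA (mulrA x) xE.
Qed.

(** With [t = e(1 - f)] and [txt = t], the element [e - txe] lies in both [Se] and [Sf], hence
    vanishes. *)
Lemma right_coprime_compl (e f : S) : e * e = e ->
  (forall y, y * e = y -> y * f = y -> y = 0) -> right_coprime (1 - e) (1 - f).
Proof.
move=> ee ef0; pose t := e * (1 - f).
have [x tE] := regS t.
have /subr0_eq E : e - t * x * e = 0.
  apply: ef0; first by rewrite mulrBl ee -(mulrA _ e) ee.
  apply/esym/eqP; rewrite -subr_eq0 -[X in X - _]mulr1 -mulrBr.
  by rewrite mulrBl -(mulrA _ e) -/t tE subrr.
(* [w] lies in [(1 - f)S], and [ew = e] gives [(1 - e)(1 - w) = 1 - w]. *)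
pose w := (1 - f) * x * e; have ew : e * w = e.
  by rewrite /w {3}E /t !mulrA.
apply/right_coprimeP; exists (1 - w), (x * e).
by rewrite mulrA -/w mulrBl mul1r mulrBr mulr1 ew subrr subr0 subrK.
Qed.

(** The [D]-component [d] of 1 satisfies [D = Sd]. By injectivity its preimage [n] generates [N],
    and [Sn] is generated by an idempotent. *)
Lemma regular_ring_C2 : @continuous_C2 S S^o.
Proof.
move=> N D /left_idealP[N0 ND NM] [/left_idealP[D0 DD DM]].
move=> [E [/left_idealP[E0 ED EM] DE0 DE]] [f [flin [fD finj fsurj]]].
have f0 : f 0 = 0.
  have := flin 0 0 (mem_set N0) (mem_set N0) 1.
  by rewrite !scale1r addr0 => /esym/(canRL (addKr _)); rewrite addNr.
have fM a x : N x -> f (a * x) = a * f x.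
  move=> Nx; have := flin x 0 (mem_set Nx) (mem_set N0) a.
  by rewrite f0 !addr0.
have [d Dd [d' Ed' dd']] : add_set D E 1 by rewrite DE.
have dE x : D x -> x * d = x.
  move=> Dx; apply/esym/subr0_eq.
  have : (D `&` E) (x - x * d); last by rewrite DE0.
  split; first by rewrite -mulNr; apply: DD => //; exact: DM.
  rewrite -[X in X - _]mulr1 -mulrBr -dd' addrC addKr; exact: EM.
have [n Nn fn] := fsurj d Dd.
have [z [ww nw]] := regular_left_idempotent n.
have -> : N = [set x | x * (z * n) = x]; last exact: idempotent_direct_summand.
apply/seteqP; split=> [x Nx|x <-] /=; last by rewrite mulrA; exact: NM.
have -> : x = f x * n.
  apply: finj; [exact/mem_set| exact/mem_set/NM|].
  by rewrite fM // fn dE //; exact: fD.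
by rewrite -mulrA nw.
Qed.

End RegularRings.

(** * The Jacobson radical and units *)

Section JacobsonQuotient.
Variable R : pzRingType.
Local Notation S := (jacobson_quot R).
Implicit Types a b e f h j r : R.

Definition jacobson_pi (x : R) : S := \pi_(jacobson_quot R) x.

Fact jacobson_pi_zmod_morphism : zmod_morphism jacobson_pi.
Proof.
move=> x y; apply: (@addIr _ (jacobson_pi y)).
by rewrite subrK /jacobson_pi -jacobson_quotD subrK.
Qed.

Fact jacobson_pi_monoid_morphism : monoid_morphism jacobson_pi.
Proof. by split=> // x y; exact: jacobson_quotM. Qed.

HB.instance Definition _ :=
  GRing.isZmodMorphism.Build R S jacobson_pi jacobson_pi_zmod_morphism.
HB.instance Definition _ :=
  GRing.isMonoidMorphism.Build R S jacobson_pi jacobson_pi_monoid_morphism.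

Lemma jacobson_pi_surj (x : S) : exists y, x = jacobson_pi y.
Proof. by exists (repr x); rewrite /jacobson_pi reprK. Qed.

Lemma jacobson_pi_eq x y :
  jacobson_pi x = jacobson_pi y <-> jacobson_radical (x - y).
Proof. exact: jacobson_quotE. Qed.

Lemma left_ideal_sub_maximal (L : set R) : left_ideal L -> ~ L 1 ->
  exists M, maximal_left_ideal M /\ L `<=` M.
Proof.
move=> idL L1.
pose Q : set (set R) := [set M | [/\ left_ideal M, L `<=` M & ~ M 1]].
pose le (A B : Q) := `[< val A `<=` val B >].
have QP (A : Q) : Q (val A) by exact/set_mem/valP.
have [||||M Mmax] := @Zorn Q le.
- by move=> A; apply/asboolP.
- by move=> A B C /asboolP AB /asboolP BC; apply/asboolP/(subset_trans AB).
- by move=> A B /asboolP AB /asboolP BA; apply/val_inj/seteqP.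
- move=> F totF; have [[A0 FA0]|F0] := pselect (F !=set0); last first.
    have QL : Q L by split.
    by exists (exist _ L (mem_set QL)) => A FA; case: F0; exists A.
  pose U : set R := [set x | exists2 A, F A & val A x].
  have QU : Q U.
    split=> [|x Lx|[A _]]; last by have [] := QP A.
      apply/left_idealP; split.
      + by exists A0 => //; have [/left_idealP[]] := QP A0.
      + move=> x y [A FA Ax] [B FB By].
        have [[/left_idealP[_ AD _] _ _] [/left_idealP[_ BD _] _ _]] := (QP A, QP B).
        have [/asboolP AB|/asboolP BA] := totF _ _ FA FB.
          by exists B => //; apply: BD => //; exact: AB.
        by exists A => //; apply: AD => //; exact: BA.
      + move=> a x [A FA Ax]; exists A => //.
        by have [/left_idealP[_ _ AM] _ _] := QP A; exact: AM.
    by exists A0 => //; have [_ LA _] := QP A0; exact: LA.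
  by exists (exist _ U (mem_set QU)) => A FA; apply/asboolP => x Ax; exists A.
have [idM LM M1] := QP M; exists (val M); split=> //; split=> //.
  by move=> MT; apply: M1; rewrite MT.
move=> N idN MN NT; have QN : Q N.
  split=> //; first exact: subset_trans MN.
  move=> N1; apply: NT; apply/seteqP; split=> // x _; rewrite -[x]mulr1.
  by have [_ _] := (left_idealP _).1 idN; exact.
by rewrite -(Mmax (exist _ N (mem_set QN))) //; apply/asboolP.
Qed.

(** A left inverse [u] of [1 - j] equals [1 + uj], so it has a left inverse as well and is a
    unit. *)
Lemma jacobson_radical_unit j : jacobson_radical j ->
  exists u, u * (1 - j) = 1 /\ (1 - j) * u = 1.
Proof.
have left_inv (x : R) : jacobson_radical x -> exists u, u * (1 - x) = 1.
  move=> Jx; apply: contrapT => nu.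
  pose L : set R := [set y | exists z, y = z * (1 - x)].
  have [||M [maxM LM]] := @left_ideal_sub_maximal L.
  - apply/left_idealP; split=> [|_ _ [z ->] [t ->]|a _ [z ->]].
    + by exists 0; rewrite mul0r.
    + by exists (z + t); rewrite mulrDl.
    + by exists (a * z); rewrite mulrA.
  - by move=> [z E]; apply: nu; exists z.
  have [/left_idealP[M0 MD MM] Mproper _] := maxM.
  have M1 : M 1.
    rewrite -(subrK x 1); apply: MD; last exact: Jx.
    by apply: LM; exists 1; rewrite mul1r.
  by apply: Mproper; apply/seteqP; split=> // y _; rewrite -[y]mulr1; exact: MM.
move=> Jj; have [u uE] := left_inv j Jj.
have [_ _ JM] := (left_idealP _).1 (jacobson_left_ideal R).
have /left_inv[v vE] : jacobson_radical (- (u * j)) by rewrite -mulNr; exact: JM.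
have uj : 1 - - (u * j) = u.
  by rewrite opprK -{1}uE mulrBr mulr1 subrK.
rewrite uj in vE; exists u; split=> //.
by have := congr1 ( *%R v) uE; rewrite mulrA vE mul1r mulr1 => ->.
Qed.

(** An element congruent to 1 modulo the radical is a unit. *)
Lemma right_coprime_lift a b :
  right_coprime (jacobson_pi a) (jacobson_pi b) -> right_coprime a b.
Proof.
move=> /right_coprimeP[x' [y']].
have [[x ->] [y ->]] := (jacobson_pi_surj x', jacobson_pi_surj y').
rewrite -!rmorphM -rmorphD -(rmorph1 jacobson_pi) => /esym/jacobson_pi_eq.
move=> /jacobson_radical_unit[u [_]]; rewrite subKr => E.
by apply/right_coprimeP; exists (x * u), (y * u); rewrite !mulrA -mulrDl.
Qed.

(* If 1 - ar is right invertible for all r, then it is a unit, and so is 1 - ra. *)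
Lemma jacobson_radical_right_inv a :
  (forall r, exists v, (1 - a * r) * v = 1) -> jacobson_radical a.
Proof.
move=> inv L [/left_idealP[L0 LD LM] Lproper Lmax]; apply: contrapT => nLa.
pose L' : set R := [set y | exists r l, L l /\ y = r * a + l].
have [r [l [Ll E]]] : L' 1.
  apply: contrapT => nL'1; apply: nLa; have -> : L = L'.
    apply/esym/Lmax; last by move=> L'T; apply: nL'1; rewrite L'T.
      apply/left_idealP; split=> [|_ _ [r [l [Ll ->]]] [s [m [Lm ->]]]|].
      - by exists 0, 0; rewrite mul0r addr0.
      - by exists (r + s), (l + m); split; [exact: LD|rewrite mulrDl addrACA].
      - move=> b _ [r [l [Ll ->]]].
        by exists (b * r), (b * l); split; [exact: LM|rewrite mulrDr mulrA].
    by move=> l Ll; exists 0, l; rewrite mul0r add0r.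
  by exists 1, 0; rewrite mul1r addr0.
have [v vE] := inv r.
(* [v] has again the form [1 - ar'], so it is right invertible too, hence a two-sided inverse of
   [1 - ar]. *)
have vE' : v = 1 - a * (- (r * v)).
  by rewrite mulrN opprK mulrA -[X in X + _]vE mulrBl mul1r subrK.
have [w wE] := inv (- (r * v)).
rewrite -vE' in wE.
have vE2 : v * (1 - a * r) = 1.
  by have := congr1 ( *%R (1 - a * r)) wE; rewrite mulrA vE mul1r mulr1 => <-.
have lE : l = 1 - r * a by rewrite E addrC addKr.
apply: Lproper; apply/seteqP; split=> // y _.
have var : v * (a * r) = v - 1 by rewrite -vE2 mulrBr mulr1 subKr.
have rvara : r * v * a * (r * a) = r * v * a - r * a.
  by rewrite -!mulrA (mulrA a r) (mulrA v) var mulrBl mul1r mulrBr.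
(* [1 + rva] is the usual left inverse of [1 - ra] obtained from the inverse [v] of [1 - ar]. *)
have -> : y = y * (1 + r * v * a) * l; last exact: LM.
rewrite lE -mulrA mulrDl mul1r mulrBr mulr1 rvara.
by rewrite subKr subrK mulr1.
Qed.

(** * Regularity and (C1) for [R/J(R)] *)

Hypothesis hR : has_minimal_lower_bounds R.

(** If 0 were the only idempotent of [aR], [exchange] at [ar] would make every [1 - ar] right
    invertible. *)
Lemma nonzero_idempotent a : ~ jacobson_radical a ->
  exists e, [/\ e * e = e, principal_right_ideal a e & e != 0].
Proof.
move=> nJa; apply: contrapT => nid; apply: nJa.
apply: jacobson_radical_right_inv => r.
have [e [ee [x _ ex] [y _ ey]]] := exchange hR (a * r).
have [e0|ne0] := eqVneq e 0; first by exists y; rewrite ey e0 subr0.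
by case: nid; exists e; split=> //; exists (r * x); rewrite // mulrA.
Qed.

(* Among the idempotents e in aR take one with Re maximal; if (1 - e)a were not
   in J, a nonzero idempotent f of (1 - e)aR would make e + f(1 - e) larger. *)
Lemma jacobson_quot_regular : regular_ring S.
Proof.
move=> x.
have [a ->] := jacobson_pi_surj x.
pose Q : set R := [set e | e * e = e /\ principal_right_ideal a e].
have [||e [[ee [s _ sE]] emax]] := @maximal_idempotent R Q 0.
- by split; [rewrite mul0r|exists 0; rewrite ?mulr0].
- move=> P PQ P0 totP; have [h [hh ah Ph]] := chain_upper_bound hR P0 totP PQ.
  by exists h.
exists (jacobson_pi s); rewrite -!rmorphM sE.
apply/esym/jacobson_pi_eq; apply: contrapT => /nonzero_idempotent.
move=> [f [ff [t _ tE] f0]]; move/eqP: f0; apply.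
have ef : e * f = 0 by rewrite -tE mulrA mulrBr mulrA ee subrr mul0r.
pose e' := e + f * (1 - e).
have ee' : e * e' = e by rewrite mulrDr ee mulrA ef mul0r addr0.
have fe : f * (1 - e) * e = 0.
  by rewrite -mulrA mulrBl mul1r ee subrr mulr0.
have : e' * e = e'.
  apply: emax => //; split.
    rewrite {1}/e' mulrDl ee' mulrDr fe add0r.
    by rewrite mulrA -(mulrA f) mulrBl mul1r ef subr0 ff.
  (* Since [as = e], multiplying by [a] gives [e + (a - ea)t(1 - e) = e + f(1 - e)]. *)
  exists (s + (t - s * a * t) * (1 - e)) => //.
  by rewrite mulrDr sE mulrA (mulrBr a) !mulrA sE -mulrBl tE.
rewrite mulrDl ee fe addr0 => /esym/(canRL (addKr _)); rewrite addNr => f1.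
move: f1; rewrite mulrBr mulr1 => /subr0_eq fE.
by rewrite -ff {1}fE -mulrA ef mulr0.
Qed.

(** For a lift [x] of [k], [exchange] at [hx] gives an idempotent [e] of [hR] with image [k];
    passing to [eh] moves it into [hRh]. *)
Lemma lift_idempotent h (k : S) : h * h = h -> k * k = k ->
  jacobson_pi h * k = k -> k * jacobson_pi h = k ->
  exists e, [/\ e * e = e, h * e = e, e * h = e & jacobson_pi e = k].
Proof.
move=> hh kk hk kh; have [x xE] := jacobson_pi_surj k.
have [e [ee [y _ yE] [z _ zE]]] := exchange hR (h * x).
have hxk : jacobson_pi (h * x) = k by rewrite rmorphM /= -xE.
have he : h * e = e by rewrite -yE !mulrA hh.
have piE : jacobson_pi e = k.
  have ke : k * jacobson_pi e = jacobson_pi e.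
    by rewrite -yE rmorphM /= hxk mulrA kk.
  have : k * (1 - jacobson_pi e) = 0.
    by rewrite -(rmorph1 jacobson_pi) -rmorphB -zE rmorphM rmorphB /= hxk rmorph1
      mulrA mulrBr mulr1 kk subrr mul0r.
  by rewrite mulrBr mulr1 ke => /subr0_eq.
exists (e * h); split.
- by rewrite mulrA -(mulrA e) he ee.
- by rewrite mulrA he.
- by rewrite -mulrA hh.
- by rewrite rmorphM /= piE.
Qed.

(** Serves maximality arguments: [Re] lies in [R(e + k)], with equality only if [k = 0]. *)
Lemma orthogonal_add_idem e k : e * e = e -> k * k = k ->
  (1 - e) * k = k -> k * (1 - e) = k ->
  [/\ (e + k) * (e + k) = e + k, e * (e + k) = e & (e + k) * e = e].
Proof.
move=> ee kk ek ke.
have ek0 : e * k = 0 by rewrite -ek mulrA mulr_compl // mul0r.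
have ke0 : k * e = 0 by rewrite -ke -mulrA mulrBl mul1r ee subrr mulr0.
by rewrite !mulrDr !mulrDl ee kk ek0 ke0 addr0 add0r.
Qed.

Lemma chain_hull (P : set R) : P !=set0 -> total_on P left_ideal_le ->
  (forall e, P e -> e * e = e) ->
  exists h, [/\ h * h = h, forall e, P e -> e * h = e &
    forall x : S, x * jacobson_pi h = x -> x != 0 -> exists s e,
      [/\ P e, s * x != 0 & s * x * jacobson_pi e = s * x]].
Proof.
move=> P0 totP idP.
(* Coprimality of [(1 - f, 1 - e)] stands for independence of [Sf] and [Se], and unlike it can be
   used directly in [R]. *)
pose Q : set R := [set f | f * f = f /\
  forall e, P e -> right_coprime (1 - f) (1 - e)].
have separate F : F `<=` Q -> F !=set0 -> total_on F left_ideal_le ->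
    exists h, [/\ h * h = h, forall e, P e -> e * h = e, Q (1 - h) &
      forall f, F f -> f * (1 - h) = f].
  move=> FQ F0 totF;
  have [||h [hh Ph cop Fh]] := separate_chains hR P0 F0 totP totF idP.
  - by move=> f /FQ[].
  - by move=> e f Pe /FQ[_]; exact.
  exists h; split=> //; split=> [|e Pe]; first exact: compl_idem.
  rewrite subKr; apply: right_coprime_sub (right_coprimeC h); last exact: cop.
  exact: principal_right_ideal_self.
have [||f [Qf fmax]] := @maximal_idempotent R Q 0.
- split=> [|e _]; first by rewrite mul0r.
  by apply/right_coprimeP; exists 1, 0; rewrite subr0 mulr0 addr0 mulr1.
- move=> F FQ F0 totF; have [h [_ _ Qh Fh]] := separate F FQ F0 totF.
  by exists (1 - h).
have [|||h [hh Ph Qh fh]] := separate [set f].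
- by move=> _ ->.
- by exists f.
- by move=> _ _ -> ->; left; exact: left_ideal_le_refl.
have {}fh : f * (1 - h) = f by exact: fh.
(* As [f(1 - h) = f] and [1 - h] is in [Q], maximality passes from [f] to [1 - h]. *)
have {}fmax g : Q g -> (1 - h) * g = 1 - h -> g * (1 - h) = g.
  move=> Qg hg; have fg : f * g = f by rewrite -fh -mulrA hg.
  have hf := fmax _ Qh fh; rewrite -[LHS](congr1 ( *%R^~ (1 - h)) (fmax _ Qg fg)).
  by rewrite -mulrA fh fmax.
exists h; split=> // x xh x0; apply: contrapT => noPx.
have [z [ww xw]] := regular_left_idempotent jacobson_quot_regular x.
set w := z * x in ww xw.
have wh : w * jacobson_pi h = w by rewrite /w -mulrA xh.
(* Modulo the radical, [hw] is an idempotent of the corner of [h] and still generates [Sx]. *)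
have [|||k [kk hk kh kE]] := @lift_idempotent h (jacobson_pi h * w) hh.
- by rewrite mulrA -(mulrA _ w) wh -mulrA ww.
- by rewrite mulrA -rmorphM hh.
- by rewrite -mulrA wh.
have [|||gg hg gh] := @orthogonal_add_idem (1 - h) k _ kk.
- exact: compl_idem.
- by rewrite subKr.
- by rewrite subKr.
set g := 1 - h + k in gg hg gh.
have Qg : Q g.
  split=> // e Pe; apply: right_coprime_lift; rewrite !rmorphB rmorph1.
  apply: (right_coprime_compl jacobson_quot_regular); first by rewrite -rmorphM gg.
  move=> y yg ye; have yh : y * jacobson_pi h = y.
    by rewrite -ye -mulrA -rmorphM Ph.
  (* The image of [gh = k] lies in [Sx], hence so does [y = ygh]; then [noPx] forces [y = 0]. *)
  have yx : y = y * z * x.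
    have gh' : g * h = k by rewrite mulrDl kh mulrBl mul1r hh subrr add0r.
    by rewrite -{1}yh -{1}yg -mulrA -rmorphM /= gh' kE mulrA yh mulrA.
  apply: contrapT => /eqP y0; apply: noPx; exists (y * z), e.
  by rewrite -yx; split.
have k0 : k = 0.
  have := fmax g Qg hg; rewrite gh => /esym/(canRL (addKr _)).
  by rewrite addNr.
have w0 : w = 0.
  by rewrite -ww -{1}wh -mulrA -kE k0 rmorph0 mulr0.
by case/eqP: x0; rewrite -xw w0 mulr0.
Qed.

(* Among the idempotents e of R for which N meets every nonzero left ideal
   inside S e, take one with Re maximal: then N is contained in S e. *)
Lemma left_ideal_hull (N : set S) : left_ideal N -> exists e : S,
  [/\ e * e = e, forall x, N x -> x * e = x &
    forall x, x * e = x -> x != 0 -> exists s, s * x != 0 /\ N (s * x)].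
Proof.
move=> /left_idealP[N0 ND NM].
pose E (e : S) := forall x, x * e = x -> x != 0 ->
  exists s, s * x != 0 /\ N (s * x).
pose Q : set R := [set e | e * e = e /\ E (jacobson_pi e)].
have [||e [[ee Ee] emax]] := @maximal_idempotent R Q 0.
- split=> [|x]; first by rewrite mul0r.
  by rewrite rmorph0 mulr0 => <-; rewrite eqxx.
- move=> P PQ P0 totP; have [|h [hh Ph hull]] := chain_hull P0 totP.
    by move=> e /PQ[].
  exists h; split=> //; split=> // x xh x0.
  have [s [e [Pe sx0 sxe]]] := hull x xh x0.
  have [_ /(_ _ sxe sx0)[t [tsx0 Ntsx]]] := PQ e Pe.
  by exists (t * s); rewrite -mulrA.
exists (jacobson_pi e); split=> [|n Nn|//]; first by rewrite -rmorphM ee.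
apply: contrapT => ne.
pose e1 := jacobson_pi e; have e1e1 : e1 * e1 = e1 by rewrite -rmorphM ee.
pose m := n - n * e1.
have me1 : m * e1 = 0 by rewrite mulrBl -mulrA e1e1 subrr.
have [z [ww mw]] := regular_left_idempotent jacobson_quot_regular m.
set w := z * m in ww mw.
have we1 : w * e1 = 0 by rewrite -mulrA me1 mulr0.
have we : w * (1 - e1) = w by rewrite mulrBr mulr1 we1 subr0.
have piC : jacobson_pi (1 - e) = 1 - e1 by rewrite rmorphB rmorph1.
have [||||k [kk ek ke kE]] := @lift_idempotent (1 - e) ((1 - e1) * w).
- exact: compl_idem.
- by rewrite mulrA -(mulrA _ w) we -mulrA ww.
- by rewrite piC mulrA compl_idem.
- by rewrite piC -mulrA we.
have [ff ef fe] := orthogonal_add_idem ee kk ek ke; set f := e + k in ff ef fe.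
have Qf : Q f.
  split=> // x xf x0.
  (* Since [x = x e1 + vm] and [m = n - n e1], this splits [x] into a part in [S e1] and a part in
     [N]. *)
  pose v := x * (1 - e1) * z; pose u := x - v * n.
  have xE : x = u * e1 + v * n.
    rewrite mulrBl -addrA [- _ + _]addrC -(mulrA v) -mulrBr -/m.
    by rewrite -[LHS]xf rmorphD /= kE mulrDr /w /v !mulrA.
  have [t [tt xt]] := regular_left_idempotent jacobson_quot_regular x.
  set p := t * x in tt xt.
  (* The factor [p] on the left of the first term ensures that [sp] is nonzero whenever [s] does not
     kill that term. *)
  have pE : p = p * (t * u * e1) + p * (t * v * n).
    by rewrite -mulrDr -(mulrA t u) -(mulrA t v) -mulrDr -xE -/p tt.
  have Np : N (p * (t * v * n)) by rewrite mulrA; exact: NM.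
  have [y0|y0] := eqVneq (p * (t * u * e1)) 0.
    exists t; rewrite -/p; split.
      by apply: contraNneq x0 => p0; rewrite -xt p0 mulr0.
    by rewrite pE y0 add0r.
  have [|s [sy0 Ns]] := Ee _ _ y0; first by rewrite -!mulrA e1e1.
  exists (s * t); rewrite -mulrA -/p; split.
    by apply: contraNneq sy0 => sp0; rewrite (mulrA s) sp0 mul0r.
  by rewrite pE mulrDr; apply: ND => //; exact: NM.
have k0 : k = 0.
  by have := emax f Qf ef; rewrite fe => /esym/(canRL (addKr _)); rewrite addNr.
have m0 : m = 0.
  have m1 : m * (1 - e1) = m by rewrite mulrBr mulr1 me1 subr0.
  by rewrite -mw -m1 -mulrA -kE k0 rmorph0 mulr0.
by apply: ne; apply/esym/subr0_eq.
Qed.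

Lemma jacobson_quot_C1 : @continuous_C1 S S^o.
Proof.
move=> N idN; have [e [ee Ne hull]] := left_ideal_hull idN.
exists [set x | x * e = x]; split; first exact: idempotent_direct_summand.
split=> // K /left_idealP[K0 KD KM] Ke KN.
apply/seteqP; split=> [x Kx|_ ->] //=.
apply: contrapT => /eqP x0; have [s [/eqP sx0 Nsx]] := hull x (Ke x Kx) x0.
apply: sx0; have : (K `&` N) (s * x) by split=> //; exact: KM.
by rewrite KN.
Qed.

End JacobsonQuotient.

Theorem theorem4p9 (R : pzRingType)
  (hR : forall (d : Order.disp_t) (I : porderType d) (p : I -> RCP R),
     descending_system p -> compatible p ->
     exists m : RCP R, minimal_lower_bound p m) :
  left_continuous (jacobson_quot R).
Proof.
split; first exact: jacobson_quot_C1.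
exact/regular_ring_C2/jacobson_quot_regular.
Qed.
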